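(* Let $p\ge 2$, and let $H$ be the Hilbert transform on $\mathbb{R}$. There is a constant $c>0$ depending only on $p$ such that for all $t\ge 1$, $$\varphi_{H_p}(t)\ge c\,t,$$ where $\varphi_{H_p}(t):=\sup_{[w]_{A_p}\le t}\|H_{w,p}\|_{L^p\to L^{p,\infty}}$.
   Context: The Hilbert transform is $Hf(x)=\mathrm{P.V.}\int_{\mathbb{R}}\frac{f(t)}{x-t}\,dt$. A scalar weight $w$ is a non-negative locally integrable function on $\mathbb{R}$, and for $p>1$ $$[w]_{A_p}:=\sup_{I}\Big(\frac{1}{|I|}\int_Iw\Big)\Big(\frac{1}{|I|}\int_Iw^{-\frac{1}{p-1}}\Big)^{p-1},$$ the supremum being over all bounded intervals $I\subset\mathbb{R}$. For a weight $w$ with $[w]_{A_p}<\infty$, $H_{w,p}f(x):=w(x)^{1/p}H(fw^{-1/p})(x)$. The weak norm (with respect to Lebesgue measure) is $\|g\|_{L^{p,\infty}}=\sup_{\alpha>0}\alpha\,|\{x\in\mathbb{R}:|g(x)|>\alpha\}|^{1/p}$, and $\|H_{w,p}\|_{L^p\to L^{p,\infty}}$ is the smallest constant $K$ with $\|H_{w,p}f\|_{L^{p,\infty}}\le K\|f\|_{L^p}$ for all $f\in L^p(\mathbb{R})$. The supremum defining $\varphi_{H_p}(t)$ is over all scalar weights $w$ with $[w]_{A_p}\le t$. *)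

(* Defs.v *)
From HB Require Import structures.
From mathcomp Require Import all_boot all_order all_algebra.
From mathcomp Require Import all_classical all_reals all_analysis.

Set Implicit Arguments.
Unset Strict Implicit.
Unset Printing Implicit Defensive.

Import Order.TTheory GRing.Theory Num.Theory.
Import numFieldNormedType.Exports.

Local Open Scope classical_set_scope.
Local Open Scope ring_scope.

(* Functions on the line are Borel representatives: every Lebesgue measurable
   function agrees almost everywhere with a Borel one. *)
Definition is_weight (R : realType) (w : R -> R) : Prop :=
  (forall x, 0 <= w x) /\ locally_integrable [set: R] w.

Definition average (R : realType) (i : interval R) (a b : R)
    (g : R -> \bar R) : \bar R :=
  ((b - a)^-1%:E * \int[lebesgue_measure]_(x in [set` i]) g x)%E.

(* w^(-1/(p-1)).  The inverse is taken in the extended reals, where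
   0^-1 = +oo; the real power (0 `^ r = 0 for r != 0) would hide the zeros
   of w. *)
Definition dual_weight (R : realType) (p : R) (w : R -> R) (x : R) : \bar R :=
  ((w x `^ (p - 1)^-1)%:E^-1)%E.

(* All nondegenerate bounded intervals; bl and br say whether the endpoints
   a and b belong to the interval.  A weight which is not almost everywhere 0
   but vanishes on a set of positive measure gets the value +oo.  The product
   0 * +oo is 0, so the null weight gets the value 0. *)
Definition Ap_const (R : realType) (p : R) (w : R -> R) : \bar R :=
  ereal_sup [set z : \bar R | exists (a b : R) (bl br : bool),
    let i := Interval (BSide bl a) (BSide br b) in
    a < b /\
    z = (average i a b (EFin \o w) *
         average i a b (dual_weight p w) `^ (p - 1))%E].

Definition truncated_hilbert (R : realType) (f : R -> R) (eps x : R) : R :=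
  \int[lebesgue_measure]_(t in [set t : R | eps < `|x - t|]) (f t / (x - t)).

(* Meaningful where the limit exists, hence almost everywhere for the
   functions f * w^(-1/p) with f in L^p and w in A_p; lim is a default value
   elsewhere. *)
Definition hilbert (R : realType) (f : R -> R) (x : R) : R :=
  lim (truncated_hilbert f eps x @[eps --> 0^'+]).

(* A weight with finite, nonzero Ap_const is positive almost everywhere, so
   the value of the real power w^(-1/p) at the zeros of w is irrelevant. *)
Definition weighted_hilbert (R : realType) (p : R) (w f : R -> R) (x : R) : R :=
  w x `^ p^-1 * hilbert (fun t => f t * w t `^ (- p^-1)) x.

Definition weak_norm (R : realType) (p : R) (g : R -> R) : \bar R :=
  ereal_sup [set (alpha%:E *
      lebesgue_measure [set x : R | (alpha < `|g x|)%R] `^ p^-1)%E |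
    alpha in [set alpha : R | 0 < alpha]].

(* ereal_inf set0 = +oo: the norm of an unbounded operator is +oo. *)
Definition weak_op_norm (R : realType) (p : R) (T : (R -> R) -> (R -> R)) :
    \bar R :=
  ereal_inf [set K%:E | K in [set K : R | 0 <= K /\
    forall f : R -> R, f \in Lfun lebesgue_measure p%:E ->
      (weak_norm p (T f) <=
       K%:E * 'N[lebesgue_measure]_(p%:E) [EFin \o f])%E]].

Definition phi_hilbert (R : realType) (p t : R) : \bar R :=
  ereal_sup [set weak_op_norm p (weighted_hilbert p w) |
    w in [set w : R -> R | is_weight w /\ (Ap_const p w <= t%:E)%E]].

(* Main.v *)
Require Import Defs.
From mathcomp Require Import all_boot all_order all_algebra.
From mathcomp Require Import all_classical all_reals all_analysis.
From mathcomp Require Import measurable_realfun.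
From mathcomp Require Import lra.

Set Implicit Arguments.
Unset Strict Implicit.
Unset Printing Implicit Defensive.

Import Order.TTheory GRing.Theory Num.Theory.
Import numFieldNormedType.Exports.

Local Open Scope classical_set_scope.
Local Open Scope ring_scope.

(** Fix [L >= 1], put [r = exp(-L)] and consider the weight
    [w(x) = 1 + L/r] for [|x| < r] and [w(x) = 1 + 1/|x|] for [|x| >= r].

    The tail [1/|x|] puts mass [ln(1/r) = L] on [r < x < 1], and the central
    plateau is raised so that [0 < x < r] carries about the mass [L] too, at
    the single height [L/r].  The mean of [w] over [(0, R)] is therefore at
    most [2 L w(R)] for every [R > 0] ([integral_peaked_weight]), and since
    [w] is radially decreasing this makes it an A_1 weight, hence an A_p
    weight, with constant at most [8 L] ([Ap_const_le_A1],
    [Ap_const_peaked_weight]).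

    Test the operator on [f = 1_[0,1] w^(1/p)].  On one side
    [||f||_p^p = int_0^1 w <= 4 L].  On the other side
    [|H 1_[0,1](x)| = ln((1 - x)/(-x)) > L] for [-r < x < 0], where [w] is at
    least [L/r]; so [|H_(w,p) f|] exceeds [L (L/r)^(1/p)] on a set of measure
    [r], and the weak norm is at least [L L^(1/p)].  The quotient is at least
    [L 4^(-1/p) >= L/4] ([weak_op_norm_ge]).  A pure power
    [|x|^(-1+1/L)] has the same strong norm growth, but spreads the mass of
    [|H_(w,p) f|^p] over about [L] different heights, which the weak norm
    does not add up; the plateau collects it at one height.

    For [t >= 8] take [L = t/8]; for [1 <= t < 8] the weight [1] and the same
    test function give a fixed positive lower bound. *)

(** * Integrals on the line *)

Section IntegralsOnTheLine.
Context {R : realType}.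
Implicit Types s a b r : R.

Lemma integral_cst_itv (c : R) a b : a <= b ->
  (\int[lebesgue_measure]_(x in `[a, b]) (cst c%:E x) = (c * (b - a))%:E)%E.
Proof.
rewrite integral_cst//= lebesgue_measure_itv/= lte_fin le_eqVlt.
move=> /predU1P[->|ab]; first by rewrite ltxx subrr mulr0 mule0.
by rewrite ab -EFinD -EFinM.
Qed.

Lemma integral_inv_shift s a b : a < b -> 0 < s + a ->
  (\int[lebesgue_measure]_(t in `[a, b]) ((s + t)^-1)%:E =
   (ln (s + b) - ln (s + a))%:E)%E.
Proof.
move=> ab sa.
have dF t : a <= t -> is_derive t (1 : R) (fun u => ln (s + u)) (s + t)^-1.
  move=> at_; have st : 0 < s + t by apply: (lt_le_trans sa); rewrite lerD2l.
  have dln := is_derive1_ln st.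
  have dadd : is_derive t 1 (fun u => s + u) (0 + 1) by exact: is_deriveD.
  have := @is_derive1_comp _ (@ln R) (fun u => s + u) t _ _ dln dadd.
  by rewrite add0r mulr1.
have cF t : a <= t -> {for t, continuous (fun u => ln (s + u))}.
  move=> at_; apply: differentiable_continuous; apply/derivable1_diffP.
  by have [] := dF _ at_.
rewrite (@continuous_FTC2 _ _ (fun u => ln (s + u)))//.
- apply: continuous_in_subspaceT => x; rewrite inE/= in_itv/= => /andP[ax _].
  have sx : 0 < s + x by apply: (lt_le_trans sa); rewrite lerD2l.
  apply: continuousV; first by rewrite gt_eqF.
  by apply: continuousD; [exact: cvg_cst | exact: cvg_id].
- split.
  + by move=> x; rewrite in_itv/= => /andP[/ltW ax _]; have [] := dF _ ax.
  + by apply: cvg_at_right_filter; apply: cF.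
  + by apply: cvg_at_left_filter; apply: cF; exact: ltW.
- move=> x; rewrite in_itv/= => /andP[/ltW ax _].
  by rewrite derive1E; have [] := dF _ ax.
Qed.

(** Reflection invariance of Lebesgue measure gives this for functions that
    are merely measurable, where substitution rules would ask for
    continuity. *)
Lemma ge0_integral_even (f : R -> R) r :
  0 <= r -> (forall x, 0 <= f x) -> measurable_fun setT f ->
  (forall x, f (- x) = f x) ->
  (\int[lebesgue_measure]_(x in `[(- r)%R, r]) (f x)%:E =
   2%:E * \int[lebesgue_measure]_(x in `[0%R, r]) (f x)%:E)%E.
Proof.
move=> r0 f0 mf fN.
have mfE (A : set R) : measurable_fun A (fun x => (f x)%:E).
  by apply/measurable_EFinP; exact: measurable_funTS.
have neg : (\int[lebesgue_measure]_(x in `[(- r)%R, 0%R[) (f x)%:E =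
    \int[lebesgue_measure]_(x in `[0%R, r]) (f x)%:E)%E.
  rewrite -[RHS]integral_itv_obnd_cbnd//.
  transitivity (\int[pushforward lebesgue_measure
      (-%R : measurableTypeR R -> measurableTypeR R)]_(x in `]0%R, r]) (f x)%:E)%E.
    rewrite ge0_integral_pushforward//; last 2 first.
    - exact: mfE.
    - by move=> x _; rewrite lee_fin.
    have -> : (-%R : R -> R) @^-1` `]0, r] = `[- r, 0[%classic.
      by apply/seteqP; split=> x /=; rewrite !in_itv/= oppr_gt0 lerNl andbC.
    by apply: eq_integral => x _ /=; rewrite fN.
  by apply: eq_measure_integral => A mA _; exact: lebesgue_measureN.
have -> : `[- r, r]%classic = `[- r, 0[%classic `|` `[0, r]%classic :> set R.
  by rewrite -itv_bndbnd_setU// bnd_simp ?oppr_le0.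
rewrite ge0_integral_setU//=.
- by rewrite neg mule_natl mule2n.
- exact: mfE.
- by move=> x _; rewrite lee_fin.
- by apply/disj_setPLR => x /=; rewrite !in_itv/= => /andP[_ x0]; apply/negP; rewrite leNgt x0.
Qed.

End IntegralsOnTheLine.

(** * The Hilbert transform of an indicator *)

(** Off the support no principal value is involved: the truncated integrals
    stop depending on [eps] once [eps < -x]. *)
Lemma hilbert_indic01 (R : realType) (x : R) : x < 0 ->
  hilbert \1_`[0, 1] x = ln (- x) - ln (1 - x).
Proof.
move=> x0; apply: cvg_lim => //; apply: cvg_near_cst; near=> eps.
have epsx : eps < - x by near: eps; apply: nbhs_right_lt; rewrite oppr_gt0.
rewrite /truncated_hilbert /Rintegral.
transitivity (fine (\int[lebesgue_measure]_(t in `[0%R, 1%R])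
    (- ((- x + t)^-1)%:E))%E).
  congr fine; rewrite integral_mkcond [RHS]integral_mkcond.
  apply: eq_integral => t _; rewrite !patchE indicE.
  have [|] := boolP (t \in `[0%R, 1%R]%classic); last first.
    by move=> _; case: ifP => // _; rewrite mul0r.
  rewrite inE/= in_itv/= => /andP[t0 t1].
  rewrite mem_set/=; last by rewrite ltr0_norm; lra.
  by rewrite mul1r; apply/congr1; rewrite -invrN opprD opprK.
rewrite integral_ge0N; last first.
  move=> t/=; rewrite in_itv/= => /andP[t0 t1].
  by rewrite lee_fin invr_ge0; lra.
rewrite integral_inv_shift//=; first by rewrite addr0 opprB (addrC (- x)).
by rewrite addr0 oppr_gt0.
Unshelve. all: by end_near.
Qed.

(** * From A_1 to A_p *)

Section Weights.
Context {R : realType}.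
Implicit Types (p a b C m : R) (w : R -> R).

(** Bounding over the closed interval treats the four kinds of endpoints at
    once. *)
Lemma average_le (i j : bool) a b (g : R -> \bar R) C :
  a < b -> measurable_fun setT g -> (forall x, (0 <= g x)%E) ->
  (\int[lebesgue_measure]_(x in `[a, b]) g x <= (C * (b - a))%:E)%E ->
  (0 <= average (Interval (BSide i a) (BSide j b)) a b g <= C%:E)%E.
Proof.
move=> ab mg g0 leC; apply/andP; split.
  apply: mule_ge0; first by rewrite lee_fin invr_ge0 subr_ge0 ltW.
  by apply: integral_ge0 => x _; exact: g0.
rewrite /average lee_pdivrMl ?subr_gt0// -EFinM mulrC.
apply: le_trans leC; apply: ge0_subset_integral => //.
- exact: measurable_funTS.
- move=> x /=; rewrite !itv_boundlr/= => /andP[ax xb].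
  by rewrite (le_trans _ ax) ?(le_trans xb) ?bnd_simp//; case: (i) (j) => [] [].
Qed.

(** The hypothesis is the A_1 condition: on each interval a lower bound [m]
    for [w] controls the mean of [w] by [C m].  It bounds the dual factor by
    [1/m], so the two factors multiply to at most [C]. *)
Lemma Ap_const_le_A1 p w C :
  1 < p -> 0 <= C -> (forall x, 0 < w x) -> measurable_fun setT w ->
  (forall a b, a < b -> exists m, [/\ 0 < m,
      (forall x, a <= x <= b -> m <= w x) &
      (\int[lebesgue_measure]_(x in `[a, b]) (w x)%:E <=
       (C * m * (b - a))%:E)%E]) ->
  (Ap_const p w <= C%:E)%E.
Proof.
move=> p1 C0 w0 mw A1; apply: ge_ereal_sup => _ [a [b [bl [br [ab ->]]]]].
have [m [m0 mle leC]] := A1 a b ab.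
have q0 : 0 < p - 1 by rewrite subr_gt0.
have dualE x : dual_weight p w x = ((w x `^ (- (p - 1)^-1))%:E).
  by rewrite /dual_weight inver gt_eqF ?powR_gt0// powRN.
have mdual : measurable_fun setT (dual_weight p w).
  rewrite (_ : dual_weight p w = fun x => (w x `^ (- (p - 1)^-1))%:E); last first.
    by apply/funext => x; exact: dualE.
  apply/measurable_EFinP.
  exact: (measurableT_comp (measurable_powR _)).
have := @average_le bl br a b (EFin \o w) (C * m) ab.
move=> /(_ _ _ leC) /andP[||av0 avC].
  exact/measurable_EFinP.
  by move=> x /=; rewrite lee_fin ltW.
set c := m `^ (- (p - 1)^-1).
have c0 : 0 <= c by exact: powR_ge0.
have := @average_le bl br a b (dual_weight p w) c ab mdual.
move=> /(_ _ _) /andP[||dv0 dvc].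
- by move=> x; rewrite dualE lee_fin powR_ge0.
- apply: (@le_trans _ _ (\int[lebesgue_measure]_(x in `[a, b]) (cst c%:E x))%E).
    apply: ge0_le_integral => //.
    + by move=> x _; rewrite dualE lee_fin powR_ge0.
    + exact: measurable_funTS.
    + move=> x /=; rewrite in_itv/= => axb; rewrite dualE lee_fin /c !powRN.
      rewrite lef_pV2 ?posrE ?powR_gt0//.
      by rewrite ge0_ler_powR ?nnegrE ?invr_ge0 ?(ltW m0) ?(ltW q0) ?(ltW (w0 x))// mle.
  by rewrite integral_cst//= lebesgue_measure_itv/= lte_fin ab -EFinD -EFinM.
apply: (@le_trans _ _ ((C * m)%:E * (m^-1)%:E)%E); last first.
  by rewrite -EFinM lee_fin mulfK ?gt_eqF.
apply: lee_pmul => //; first exact: poweR_ge0.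
have -> : m^-1%:E = (c%:E `^ (p - 1))%E.
  by rewrite poweR_EFin /c -powRrM mulNr mulVf ?gt_eqF// powR_inv1 ?ltW.
apply: gt0_ler_poweR => //; first exact: ltW.
- by rewrite in_itv/= dv0 leey.
- by rewrite in_itv/= lee_fin c0 leey.
Qed.

End Weights.

(** * A lower bound for the weak operator norm *)

(** The test function is [f = 1_[0,1] w^(1/p)], chosen so that
    [f w^(-1/p)] is an indicator while [||f||_p^p] is the integral of [w] over
    [[0, 1]].  On [(-r, 0)] the transform is logarithmically large, and there
    [w] is at least [h]. *)
Lemma weak_op_norm_ge (R : realType) (p : R) (w : R -> R) (r h B : R) :
  0 < p -> 0 < r < 1 -> 0 < h -> 0 < B ->
  (forall x, 0 < w x) -> measurable_fun setT w ->
  (forall x, - r < x < 0 -> h <= w x) ->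
  (\int[lebesgue_measure]_(x in `[0%R, 1%R]) (w x)%:E <= B%:E)%E ->
  ((- ln r * (h * r / B) `^ p^-1)%:E <=
     weak_op_norm p (weighted_hilbert p w))%E.
Proof.
move=> p0 /andP[r0 r1] h0 B0 w0 mw hw intw.
have lnr : 0 < - ln r by rewrite oppr_gt0 ln_lt0// r0.
have pV0 : 0 < p^-1 by rewrite invr_gt0.
apply: le_ereal_inf_tmp => _ [K [K0 HK] <-].
pose f t := \1_`[0, 1]%classic t * w t `^ p^-1.
have mf : measurable_fun setT f.
  by apply: measurable_funM => //; exact: (measurableT_comp (measurable_powR _)).
have normf : ('N[lebesgue_measure]_(p%:E) [EFin \o f] <= (B `^ p^-1)%:E)%E.
  rewrite unlock -poweR_EFin; apply: gt0_ler_poweR; first exact: ltW.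
  - rewrite in_itv/= leey andbT; apply: integral_ge0 => x _.
    by rewrite lee_fin powR_ge0.
  - by rewrite in_itv/= leey andbT lee_fin ltW.
  apply: le_trans intw; rewrite [leRHS]integral_mkcond le_eqVlt.
  apply/orP; left; apply/eqP; apply: eq_integral => x _.
  rewrite patchE /f /= indicE; case: ifPn => [|] xI.
    rewrite mul1r ger0_norm ?powR_ge0// -powRrM mulVf ?gt_eqF// powRr1//.
    exact: ltW.
  by rewrite mul0r normr0 powR0 ?gt_eqF.
have fLp : f \in Lfun lebesgue_measure p%:E.
  rewrite inE; apply/andP; split; first by rewrite inE.
  by rewrite inE; exact: le_lt_trans normf (ltry _).
have {}HK : (weak_norm p (weighted_hilbert p w f) <= (K * B `^ p^-1)%:E)%E.
  by apply: le_trans (HK f fLp) _; rewrite EFinM lee_wpmul2l// lee_fin.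
pose alpha := h `^ p^-1 * - ln r.
have alpha0 : 0 < alpha by rewrite mulr_gt0// powR_gt0.
have big x : - r < x < 0 -> alpha < `|weighted_hilbert p w f x|.
  move=> /andP[rx x0]; rewrite /weighted_hilbert.
  have -> : (fun t => f t * w t `^ (- p^-1)) = \1_`[0, 1].
    apply/funext => t; rewrite /f -mulrA powRN divff ?mulr1//.
    by rewrite gt_eqF// powR_gt0.
  rewrite hilbert_indic01// normrM ger0_norm ?powR_ge0//.
  have lx : ln (- x) < ln r by rewrite ltr_ln ?posrE; lra.
  have l1 : 0 <= ln (1 - x) by rewrite ln_ge0; lra.
  rewrite ler0_norm; last lra.
  apply: (@lt_le_trans _ _ (h `^ p^-1 * (- (ln (- x) - ln (1 - x))))).
    by rewrite ltr_pM2l ?powR_gt0//; lra.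
  rewrite ler_wpM2r//; first lra.
  by rewrite ge0_ler_powR ?nnegrE ?(ltW pV0) ?(ltW h0) ?(ltW (w0 x))// hw// rx.
have mu_ge : (r%:E <= lebesgue_measure [set x : R | (alpha < `|weighted_hilbert p w f x|)%R])%E.
  have <- : lebesgue_measure (`]- r, 0[%classic : set R) = r%:E.
    by rewrite lebesgue_measure_itv/= lte_fin oppr_lt0 r0 -EFinD opprK add0r.
  (* Lebesgue measure is the restriction of an outer measure defined on all
     sets; monotonicity of the latter spares the measurability of the level
     set of the transform. *)
  rewrite /lebesgue_measure /lebesgue_stieltjes_measure /measure_extension.
  apply: le_outer_measure => x /=; rewrite in_itv/=; exact: big.
have : ((alpha * r `^ p^-1)%:E <= (K * B `^ p^-1)%:E)%E.
  apply: le_trans HK; apply: le_ereal_sup_tmp; eexists.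
    by exists alpha => //; exact: alpha0.
  rewrite EFinM lee_pmul2l// -poweR_EFin.
  apply: gt0_ler_poweR => //; first exact: ltW.
  - by rewrite in_itv/= leey andbT lee_fin ltW.
  - rewrite in_itv/= leey andbT; apply: le_trans mu_ge; by rewrite lee_fin ltW.
rewrite !lee_fin => le1.
rewrite -(@ler_pM2r _ (B `^ p^-1)) ?powR_gt0//.
apply: le_trans le1; rewrite /alpha.
have -> : h `^ p^-1 * - ln r * r `^ p^-1 = - ln r * (h * r) `^ p^-1.
  by rewrite powRM ?(ltW h0) ?(ltW r0)// mulrA (mulrC (- ln r)).
have {2}-> : h * r = h * r / B * B by rewrite divfK ?gt_eqF.
rewrite [X in _ <= _ * X]powRM ?mulrA//; last exact: ltW.
by rewrite ltW// divr_gt0// mulr_gt0.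
Qed.

(** * The extremal weight *)

Lemma bounded_is_weight (R : realType) (w : R -> R) (M : R) :
  (forall x, 0 <= w x <= M) -> measurable_fun setT w -> is_weight w.
Proof.
move=> wM mw; split; first by move=> x; case/andP: (wM x).
split => //; first exact: openT.
move=> K _ cK; have mK : measurable (K : set (measurableTypeR R)).
  exact: compact_measurable.
apply: (@le_lt_trans _ _ (\int[lebesgue_measure]_(x in K) (cst M%:E x))%E).
  apply: ge0_le_integral => //.
  - apply/measurable_EFinP; apply: measurableT_comp => //.
    exact: measurable_funTS.
  - by move=> x _; rewrite lee_fin ger0_norm; case/andP: (wM x).
rewrite integral_cst//= lte_mul_pinfty//; last exact: compact_finite_measure.
by rewrite lee_fin; case/andP: (wM 0) => [+ +]; exact: le_trans.
Qed.

(** The plateau [L / exp(-L)] is higher than the value [1 / exp(-L)] that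
    continuity would give, by a factor [L]: up to a constant factor, the largest
    jump that an A_p constant of order [L] tolerates. *)
Definition peaked_weight (R : realType) (L x : R) : R :=
  1 + (if `|x| < expR (- L) then L / expR (- L) else `|x|^-1).

Section PeakedWeight.
Context {R : realType} (L : R).
Hypothesis L1 : 1 <= L.
Implicit Types x y a b : R.

Let r := expR (- L).
Let r0 : 0 < r. Proof. exact: expR_gt0. Qed.
Let L0 : 0 < L. Proof. exact: lt_le_trans L1. Qed.
Let w := peaked_weight L.

Lemma peaked_weight_in x : `|x| < r -> w x = 1 + L / r.
Proof. by rewrite /w /peaked_weight => ->. Qed.

Lemma peaked_weight_out x : r <= `|x| -> w x = 1 + `|x|^-1.
Proof. by rewrite /w /peaked_weight leNgt => /negbTE ->. Qed.

Lemma peaked_weight_ge1 x : 1 <= w x.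
Proof.
rewrite /w /peaked_weight lerDl; case: ifP => _; last by rewrite invr_ge0.
by rewrite divr_ge0// ltW.
Qed.

Lemma peaked_weight_gt0 x : 0 < w x.
Proof. exact: lt_le_trans (peaked_weight_ge1 x). Qed.

Lemma peaked_weight_norm x : w `|x| = w x.
Proof. by rewrite /w /peaked_weight normr_id. Qed.

Lemma peaked_weight_antitone x y : `|x| <= `|y| -> w y <= w x.
Proof.
move=> xy; have [yr|ry] := ltP `|y| r.
  by rewrite !peaked_weight_in// (le_lt_trans xy).
rewrite (peaked_weight_out ry); have [xr|rx] := ltP `|x| r.
  rewrite peaked_weight_in// lerD2l (@le_trans _ _ r^-1)//.
    by rewrite lef_pV2 ?posrE// (lt_le_trans r0).
  by rewrite ler_peMl// invr_ge0 ltW.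
by rewrite peaked_weight_out// lerD2l lef_pV2 ?posrE// (lt_le_trans r0).
Qed.

Lemma peaked_weight_le x : w x <= 1 + L / r.
Proof.
by rewrite -(@peaked_weight_in 0) ?normr0// peaked_weight_antitone// normr0.
Qed.

Lemma measurable_peaked_weight : measurable_fun setT w.
Proof.
have -> : w = fun x => 1 + (if `|x| < r then L / r else `|x| `^ (-1)).
  by apply/funext => x; rewrite powR_inv1.
apply: measurable_funD => //; apply: measurable_fun_ifT => //.
  by apply: measurable_fun_ltr => //; exact: normr_measurable.
apply: (measurableT_comp (measurable_powR _)); exact: normr_measurable.
Qed.

Let mwE (A : set R) : measurable_fun A (fun x => (w x)%:E).
Proof.
by apply/measurable_EFinP; apply: measurable_funTS; exact: measurable_peaked_weight.
Qed.

Lemma integral_peaked_weight_le a b c : a <= b ->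
  (forall x, a <= x <= b -> w x <= c) ->
  (\int[lebesgue_measure]_(x in `[a, b]) (w x)%:E <= (c * (b - a))%:E)%E.
Proof.
move=> ab wc; rewrite -integral_cst_itv//; apply: ge0_le_integral => //.
- by move=> x _; rewrite lee_fin ltW// peaked_weight_gt0.
- exact: mwE.
Qed.

(** For [a >= r] the integral is at most [2 L + a + ln a]: one [L] from the
    plateau, one from the logarithm [ln (1/r)], and [a] from the summand [1];
    while [a * w a = a + 1]. *)
Lemma integral_peaked_weight a : 0 < a ->
  (\int[lebesgue_measure]_(x in `[0%R, a]) (w x)%:E <=
   (2 * L * a * w a)%:E)%E.
Proof.
move=> a0; have [ar|ra] := ltP a r.
  apply: le_trans (integral_peaked_weight_le (ltW a0) _) _.
    by move=> x _; exact: peaked_weight_le.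
  rewrite lee_fin peaked_weight_in ?gtr0_norm// subr0; set k := 1 + L / r.
  have ak : 0 <= a * k by rewrite mulr_ge0 ?addr_ge0 ?divr_ge0// ltW.
  have : a * k <= L * (a * k) by rewrite ler_peMl.
  lra.
have -> : `[0, a]%classic = `[0, r[%classic `|` `[r, a]%classic :> set R.
  by rewrite -itv_bndbnd_setU// bnd_simp// ltW.
rewrite ge0_integral_setU//=; last 3 first.
- exact: mwE.
- by move=> x _; rewrite lee_fin ltW// peaked_weight_gt0.
- by apply/disj_setPLR => x /=; rewrite !in_itv/= => /andP[_ xr]; apply/negP; rewrite leNgt xr.
have int_in : (\int[lebesgue_measure]_(x in `[0%R, r[) (w x)%:E <= (r + L)%:E)%E.
  apply: (@le_trans _ _ (\int[lebesgue_measure]_(x in `[0%R, r]) (w x)%:E)%E).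
    apply: ge0_subset_integral => //; first exact: mwE.
      by move=> x _; rewrite lee_fin ltW// peaked_weight_gt0.
    by apply: subset_itvl; rewrite bnd_simp.
  apply: le_trans (integral_peaked_weight_le (ltW r0) _) _.
    by move=> x _; exact: peaked_weight_le.
  by rewrite lee_fin subr0 mulrDl mul1r divfK ?gt_eqF.
have int_out : (\int[lebesgue_measure]_(x in `[r, a]) (w x)%:E <= (a - r + ln a + L)%:E)%E.
  move: ra; rewrite le_eqVlt => /predU1P[<-|ra].
    by rewrite set_itv1 integral_set1 lee_fin expRK; lra.
  have -> : (\int[lebesgue_measure]_(x in `[r, a]) (w x)%:E =
      \int[lebesgue_measure]_(x in `[r, a]) (cst 1%:E x + (x `^ (-1))%:E))%E.
    apply: eq_integral => x; rewrite inE/= in_itv/= => /andP[rx _].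
    have x0 : 0 < x by exact: lt_le_trans rx.
    by rewrite peaked_weight_out gtr0_norm// powR_inv1// ltW.
  rewrite ge0_integralD//; last 2 first.
  - by move=> x _; rewrite lee_fin powR_ge0.
  - by apply/measurable_EFinP; apply: measurable_funTS; exact: measurable_powR.
  have -> : (\int[lebesgue_measure]_(x in `[r, a]) (x `^ (-1))%:E =
      \int[lebesgue_measure]_(x in `[r, a]) ((0 + x)^-1)%:E)%E.
    apply: eq_integral => x; rewrite inE/= in_itv/= => /andP[rx _].
    by rewrite add0r powR_inv1// ltW// (lt_le_trans r0).
  rewrite integral_inv_shift ?add0r// integral_cst_itv; last exact: ltW.
  by rewrite -EFinD lee_fin /r expRK; lra.
apply: le_trans (leeD int_in int_out) _; rewrite -EFinD lee_fin.
rewrite peaked_weight_out gtr0_norm// mulrDr mulr1 mulfK ?gt_eqF//.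
have := ln_sublinear a0; have : a <= L * a by rewrite ler_peMl// ltW.
lra.
Qed.

(** A doubling bound; the factor [L] pays for the jump at [r], when
    [a / 2 < r <= a]. *)
Lemma peaked_weight_half a : 0 < a -> w (a / 2) <= 2 * L * w a.
Proof.
move=> a0; have a20 : 0 < a / 2 by rewrite divr_gt0.
have Lw : 2 * w a <= 2 * L * w a.
  by rewrite ler_wpM2r ?ler_peMr// ltW// peaked_weight_gt0.
have [ar|ra] := ltP (a / 2) r; last first.
  apply: le_trans Lw; rewrite !peaked_weight_out ?gtr0_norm//; last lra.
  by rewrite invf_div mulrDr mulr1 lerD2r; lra.
rewrite peaked_weight_in ?gtr0_norm//; have [ar'|ra] := ltP a r.
  apply: le_trans Lw; rewrite peaked_weight_in ?gtr0_norm//.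
  have := divr_ge0 (ltW L0) (ltW r0); lra.
rewrite peaked_weight_out ?gtr0_norm// mulrDr mulr1 lerD//.
  by have := L1; lra.
have -> : 2 * L / a = L * (2 / a) by rewrite mulrCA mulrA.
by rewrite ler_wpM2l ?(ltW L0)// -invf_div lef_pV2 ?posrE// ltW.
Qed.

(** Let [M] be the largest modulus on the interval.  If the interval is at
    least [M / 2] long, it is comparable to [[-M, M]], where the integral is
    known.  Otherwise it stays at distance [M / 2] from the origin, where [w]
    is at most [w (M / 2)]. *)
Lemma peaked_weight_A1 a b : a < b ->
  (\int[lebesgue_measure]_(x in `[a, b]) (w x)%:E <=
   (8 * L * w (Num.max `|a| `|b|) * (b - a))%:E)%E.
Proof.
move=> ab; set M := Num.max _ _.
have [aM bM] : `|a| <= M /\ `|b| <= M by rewrite !le_max !lexx orbT.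
have M0 : 0 < M.
  rewrite lt_max !normr_gt0 -negb_and; apply/negP => /andP[/eqP a0 /eqP b0].
  by move: ab; rewrite a0 b0 ltxx.
have wM0 := peaked_weight_gt0 M.
have [Mab|abM] := leP M (2 * (b - a)).
  apply: (@le_trans _ _ (\int[lebesgue_measure]_(x in `[(- M)%R, M]) (w x)%:E)%E).
    apply: ge0_subset_integral => //; first exact: mwE.
      by move=> x _; rewrite lee_fin ltW// peaked_weight_gt0.
    move: aM bM; rewrite !ler_norml => /andP[Ma _] /andP[_ bM].
    by apply: subset_itv; rewrite bnd_simp.
  rewrite ge0_integral_even//; first last.
  - by move=> x; rewrite -peaked_weight_norm normrN peaked_weight_norm.
  - exact: measurable_peaked_weight.
  - by move=> x; rewrite ltW// peaked_weight_gt0.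
  - exact: ltW.
  apply: (@le_trans _ _ (2%:E * (2 * L * M * w M)%:E)%E).
    by rewrite lee_pmul2l// integral_peaked_weight.
  rewrite -EFinM lee_fin.
  have : (L * w M) * M <= (L * w M) * (2 * (b - a)).
    by rewrite ler_wpM2l// mulr_ge0// ltW.
  lra.
have far x : a <= x <= b -> M / 2 <= `|x|.
  move=> /andP[ax xb].
  have : M <= `|x| + (b - a).
    rewrite ge_max; apply/andP; split.
      by rewrite -[X in `|X|](subrK x) addrC (le_trans (ler_normD _ _))// lerD2l distrC ger0_norm ?subr_ge0// lerD2r.
    by rewrite -[X in `|X|](subrK x) addrC (le_trans (ler_normD _ _))// lerD2l ger0_norm ?subr_ge0// lerB.
  lra.
apply: le_trans (@integral_peaked_weight_le a b (8 * L * w M) (ltW ab) _) _ => //.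
move=> x /far Mx; apply: (@le_trans _ _ (w (M / 2))).
  by apply: peaked_weight_antitone; rewrite gtr0_norm// divr_gt0.
apply: le_trans (peaked_weight_half M0) _; rewrite ler_wpM2r//; first exact: ltW.
by rewrite ler_wpM2r ?ler_nat// ltW.
Qed.

Lemma Ap_const_peaked_weight (p : R) :
  1 < p -> (Ap_const p w <= (8 * L)%:E)%E.
Proof.
move=> p1; apply: Ap_const_le_A1 => //.
- by rewrite mulr_ge0// ltW.
- exact: peaked_weight_gt0.
- exact: measurable_peaked_weight.
move=> a b ab; exists (w (Num.max `|a| `|b|)); split.
- exact: peaked_weight_gt0.
- move=> x /andP[ax xb]; apply: peaked_weight_antitone.
  rewrite (@ger0_norm _ (Num.max _ _)) ?le_max ?normr_ge0//.
  apply/orP; have [x0|/ltW x0] := leP 0 x; [right|left].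
    by rewrite ger0_norm// (le_trans xb)// ler_norm.
  by rewrite ler0_norm// -normrN (le_trans _ (ler_norm _))// lerN2.
- exact: peaked_weight_A1.
Qed.

Lemma weak_op_norm_peaked_weight (p : R) : 1 <= p ->
  ((L / 4)%:E <= weak_op_norm p (weighted_hilbert p w))%E.
Proof.
move=> p1.
have p0 : 0 < p by lra.
apply: le_trans (@weak_op_norm_ge _ p w r (L / r) (4 * L) _ _ _ _ _ _ _ _) => //.
- rewrite /r expRK opprK lee_fin ler_wpM2l//; first exact: ltW.
  rewrite divfK ?gt_eqF// invfM mulrCA divff ?gt_eqF// mulr1.
  apply: ger1_powR; last by rewrite invf_le1.
  by rewrite invr_gt0 invf_le1//= ler1n ltr0n.
- by rewrite r0/= /r expR_lt1 oppr_lt0.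
- by rewrite divr_gt0.
- by rewrite mulr_gt0.
- exact: peaked_weight_gt0.
- exact: measurable_peaked_weight.
- move=> x /andP[rx x0]; rewrite peaked_weight_in ?ler0_norm; lra.
- apply: le_trans (integral_peaked_weight ltr01) _; rewrite lee_fin.
  rewrite peaked_weight_out normr1 ?invr1; first lra.
  by rewrite /r -expR0 ler_expR oppr_le0 ltW.
Qed.

End PeakedWeight.

(** * Linear growth of the weak norm *)

Theorem theorem1p4 (R : realType) (p : R) (hp : 2 <= p) :
  exists2 c : R, 0 < c &
    forall t : R, 1 <= t -> ((c * t)%:E <= phi_hilbert p t)%E.
Proof.
have p1 : 1 < p by lra.
have e0 := expR_gt0 (-1 : R).
have e1 : expR (-1) < 1 :> R by rewrite expR_lt1 oppr_lt0.
(* The peaked weights give [t / 32] when [t >= 8], and the weight [1] gives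
   [exp(-1)], which is at least [exp(-1) t / 8] when [t < 8]. *)
exists (expR (-1) / 32) => [|t t1]; first by rewrite divr_gt0.
have phi_ge (w : R -> R) (c : R) : is_weight w -> (Ap_const p w <= t%:E)%E ->
    (c%:E <= weak_op_norm p (weighted_hilbert p w))%E ->
    (c%:E <= phi_hilbert p t)%E.
  move=> ww Aw cw; apply: le_trans cw _; apply: ereal_sup_ubound.
  by exists w.
(* [8 L] bounds the A_p constant of the peaked weight, whence [L = t / 8];
   that requires [L >= 1]. *)
have [t8|t8] := leP 8 t.
  have L1 : 1 <= t / 8 by lra.
  apply: (@le_trans _ _ (t / 8 / 4)%:E).
    rewrite lee_fin; have : expR (-1) * t <= 1 * t by rewrite ler_wpM2r; lra.
    lra.
  apply: (phi_ge (peaked_weight (t / 8))).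
  - apply: (@bounded_is_weight _ _ (1 + t / 8 / expR (- (t / 8)))).
      by move=> x; rewrite peaked_weight_le// ltW// peaked_weight_gt0.
    exact: measurable_peaked_weight.
  - apply: le_trans (Ap_const_peaked_weight L1 p1) _; rewrite lee_fin; lra.
  - exact: (weak_op_norm_peaked_weight L1 (ltW p1)).
apply: (@le_trans _ _ (expR (-1))%:E).
  rewrite lee_fin; have : expR (-1) * t <= expR (-1) * 8 :> R by rewrite ler_wpM2l; lra.
  lra.
(* Here [r = exp(-1)], so that [- ln r = 1]. *)
apply: (phi_ge (cst 1)).
- by apply: (@bounded_is_weight _ _ 1) => // x; rewrite ler01 lexx.
- apply: (@le_trans _ _ 1%:E); last by rewrite lee_fin.
  apply: Ap_const_le_A1 => // a b ab; exists 1; split => //.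
  by rewrite !mul1r -[X in (X%:E)]mul1r -integral_cst_itv// ltW.
apply: le_trans (@weak_op_norm_ge _ p (cst 1) (expR (-1)) 1 1 _ _ _ _ _ _ _ _) => //.
- rewrite expRK opprK mul1r lee_fin mul1r divr1.
  by apply: ger1_powR; [rewrite e0 ltW | rewrite invf_le1; lra].
- lra.
- by rewrite e0.
- by rewrite integral_cst_itv// lee_fin; lra.
Qed.
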